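(* There is an absolute constant $C>0$ such that the following holds. Let $\delta > 0$ and let $n$ be an integer with $n \geq \delta^{-2}$. Let $G$ be a graph on vertex set $[n]=\{1,\dots,n\}$ and let $(d_1,\dots,d_n)$ be a realizable sequence such that $$\sum_{i=1}^{n} |d_G(i) - d_i| \leq \delta n^2 .$$ Then there is a graph $G'$ on vertex set $[n]$ such that $|E(G') \triangle E(G)| \leq C\delta^{1/2} n^2$ and $d_{G'}(i) = d_i$ for every $i \in [n]$.
   Context: Graphs are finite, simple and undirected. $d_G(i)$ denotes the degree of vertex $i$ in $G$. A sequence $(d_1,\dots,d_n)$ of non-negative integers is realizable (graphic) if there is a graph $H$ on vertex set $[n]$ with $d_H(i)=d_i$ for all $i\in[n]$. $\triangle$ denotes symmetric difference. *)

(* Defs.v *)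
From mathcomp Require Import all_boot.
From Stdlib Require Import Reals.

Set Implicit Arguments.
Unset Strict Implicit.
Unset Printing Implicit Defensive.

(* A finite simple undirected graph on vertex set 'I_n (= {0,...,n-1},
   standing for [n]) is given by its edge set: a set of 2-element subsets. *)
Definition is_graph (n : nat) (E : {set {set 'I_n}}) : Prop :=
  forall e, e \in E -> #|e| = 2.

Definition deg (n : nat) (E : {set {set 'I_n}}) (i : 'I_n) : nat :=
  #|[set e in E | i \in e]|.

Definition realizable (n : nat) (d : 'I_n -> nat) : Prop :=
  exists H : {set {set 'I_n}}, is_graph H /\ forall i, deg H i = d i.

Definition absdiff (a b : nat) : nat := (a - b) + (b - a).

Definition symdiff_card (n : nat) (E F : {set {set 'I_n}}) : nat :=
  #|(E :\: F) :|: (F :\: E)|.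

(* Main.v *)
(* Let [H] realize [d].  Viewing the pairs of the bipartite double cover of the
   complete graph as oriented one way when they are edges and the other way when
   they are not, [G] and [H] become two orientations [A] and [B] of the same
   graph on [N = 2n] vertices, and fixing the degrees means giving [A] the
   out-degrees of [B].  Let [m] be the total surplus of out-degree.  If a set
   containing all vertices with a surplus contains none with a deficit, then at
   least [m] arcs of [A] leave it.  For breadth-first layers grown from the
   surplus vertices this says that the product of two consecutive layer sizes is
   at least [m], so a deficit vertex is found at distance [O(N / sqrt m)].
   Reversing such a path lowers [m] by one, and summing over all [m] reversals
   costs [O(N * sqrt m)].
   The result is a 0/1 matrix [M], possibly not symmetric, with row and column
   sums [d].  The pairs with [M u v != M v u] form a balanced digraph, which
   splits into closed trails; choosing alternately to keep and to drop the pairs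
   along each trail restores symmetry and the degrees, up to an error of one at a
   single vertex of each trail of odd length.  Once trails sharing a vertex are
   merged, the defective vertices are pairwise joined by symmetric pairs of [M],
   and there is an even number of them; match them up and flip the matched pairs,
   choosing the signs of the errors accordingly. *)
Require Import Defs.
From mathcomp Require Import all_boot all_fingroup zify.
From Stdlib Require Import Reals Lra.

Set Implicit Arguments.
Unset Strict Implicit.
Unset Printing Implicit Defensive.

(** * Orientations with prescribed out-degrees *)

(** The sum is taken in [nat]: each pair of [K] carries exactly one direction, every other pair
    none, and [K] must be false on the diagonal. *)
Definition orients (V : finType) (K A : rel V) : Prop :=
  forall u v, A u v + A v u = K u v :> nat.

Definition outdeg (V : finType) (A : rel V) (u : V) : nat := \sum_v A u v.

Definition arc_diff (V : finType) (A A' : rel V) : nat :=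
  \sum_u \sum_v (A u v && ~~ A' u v).

Definition reverse_arc (V : finType) (A : rel V) (s t : V) : rel V :=
  fun u v => if (u == s) && (v == t) then false
             else if (u == t) && (v == s) then true else A u v.

(** The subtraction truncates, so only vertices whose out-degree is too large contribute. *)
Definition surplus (V : finType) (A B : rel V) : nat :=
  \sum_u (outdeg A u - outdeg B u).

Lemma arc_diff_triangle (V : finType) (A1 A2 A3 : rel V) :
  arc_diff A1 A3 <= arc_diff A1 A2 + arc_diff A2 A3.
Proof.
rewrite -big_split; apply: leq_sum => u _; rewrite -big_split.
by apply: leq_sum => v _; case: (A1 u v) (A2 u v) (A3 u v) => [] [] [].
Qed.

Lemma sum_pred1_pair (V : finType) (s t u : V) :
  \sum_v ((u == s) && (v == t)) = (u == s) :> nat.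
Proof.
rewrite (bigD1 t) //= eqxx andbT big1 ?addn0 // => v /negbTE->.
by rewrite andbF.
Qed.

Lemma orients_neq (V : finType) (K A : rel V) (u v : V) :
  orients K A -> A u v -> (A v u = false) /\ (u != v).
Proof.
move=> KA Auv; have := KA u v; rewrite Auv.
case: (K u v); case E: (A v u) => // _; split=> //.
by apply/eqP => euv; rewrite euv -{1}euv Auv in E.
Qed.

Lemma reverse_arc_orients (V : finType) (K A : rel V) (s t : V) :
  orients K A -> A s t -> orients K (reverse_arc A s t).
Proof.
move=> KA Ast u v; have [Ats neq_st] := orients_neq KA Ast.
have := KA u v; rewrite /reverse_arc.
by case: (eqVneq u s) (eqVneq v t) (eqVneq u t) (eqVneq v s)
  => [us|_] [vt|_] [ut|_] [vs|_]; subst; rewrite ?eqxx ?Ast ?Ats //=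
  in neq_st *.
Qed.

Lemma reverse_arc_outdeg (V : finType) (K A : rel V) (s t u : V) :
  orients K A -> A s t ->
  outdeg (reverse_arc A s t) u + (u == s) = outdeg A u + (u == t).
Proof.
move=> KA Ast; have [Ats neq_st] := orients_neq KA Ast.
rewrite -{1}(sum_pred1_pair s t u) -(sum_pred1_pair t s u) -!big_split /=.
apply: eq_bigr => v _; rewrite /reverse_arc.
by case: (eqVneq u s) (eqVneq v t) (eqVneq u t) (eqVneq v s)
  => [us|_] [vt|_] [ut|_] [vs|_]; subst;
  rewrite ?eqxx ?Ast ?Ats ?addn0 //= in neq_st *.
Qed.

Lemma reverse_arc_diff (V : finType) (A : rel V) (s t : V) :
  arc_diff A (reverse_arc A s t) <= 1.
Proof.
have -> : 1 = \sum_u \sum_v ((u == s) && (v == t)).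
  rewrite (eq_bigr _ (fun u _ => sum_pred1_pair s t u)).
  by rewrite (bigD1 s) //= eqxx big1 // => v /negbTE->.
apply: leq_sum => u _; apply: leq_sum => v _; rewrite /reverse_arc.
by case: (_ && _) (_ && _) (A u v) => [] [] [].
Qed.

(** The arcs are reversed one by one from [s]. An inner vertex gains one outgoing arc and loses
    another, so only the two ends change. *)
Lemma reverse_path (V : finType) (K A : rel V) (s : V) (p : seq V) :
  orients K A -> path A s p -> uniq (s :: p) ->
  exists A' : rel V, [/\ orients K A', arc_diff A A' <= size p &
    forall u, outdeg A' u + (u == s) = outdeg A u + (u == last s p)].
Proof.
elim: p s A => [|t p IHp] s A KA /=.
  move=> _ _; exists A; split=> //; rewrite /arc_diff big1 // => u _.
  by rewrite big1 // => v _; rewrite andbN.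
move=> /andP[Ast Ap] /andP[s_tp uniq_tp].
have [|A' [KA' dA' oA']] := IHp t _ (reverse_arc_orients KA Ast) _ uniq_tp.
  (* The path is simple, so its remainder avoids [s] and survives the first reversal. *)
  have: all (predC1 s) (t :: p).
    by apply/allP => x x_tp; apply: contraNneq s_tp => <-.
  move: Ap => /[swap]; apply: (sub_in_path (e := A)).
  move=> x y /negbTE xs /negbTE ys Axy.
  by rewrite /reverse_arc xs ys andbF.
exists A'; split=> //.
  apply: leq_trans (arc_diff_triangle _ (reverse_arc A s t) _) _.
  by rewrite -add1n leq_add ?reverse_arc_diff.
move=> u; have := oA' u; have := reverse_arc_outdeg u KA Ast; lia.
Qed.

Lemma orients_inner_sum (V : finType) (K A : rel V) (R : {set V}) :
  orients K A ->
  (\sum_(u in R) \sum_(v in R) A u v).*2 = \sum_(u in R) \sum_(v in R) K u v.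
Proof.
move=> KA; rewrite -addnn {2}exchange_big -big_split /=.
apply: eq_bigr => u _; rewrite -big_split; apply: eq_bigr => v _; exact: KA.
Qed.

Lemma orients_sum_outdeg (V : finType) (K A : rel V) :
  orients K A -> (\sum_u outdeg A u).*2 = \sum_u \sum_v K u v.
Proof.
move=> KA; have := orients_inner_sum [set: V] KA.
have sumT (F : V -> nat) : \sum_(u in [set: V]) F u = \sum_u F u.
  by apply: eq_bigl => u; rewrite inE.
rewrite !sumT; under eq_bigr do rewrite sumT.
by under [X in _ = X -> _]eq_bigr do rewrite sumT.
Qed.

(** Both out-degree sums are half the sum of [K], so a deficit somewhere would force a surplus
    elsewhere. *)
Lemma surplus0 (V : finType) (K A B : rel V) :
  orients K A -> orients K B -> surplus A B = 0 -> outdeg A =1 outdeg B.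
Proof.
move=> KA KB /eqP; rewrite sum_nat_eq0 => /forallP/= AB.
have leAB u : outdeg A u <= outdeg B u by rewrite -subn_eq0.
have eq_sum : \sum_u outdeg A u = \sum_u outdeg B u.
  by apply: double_inj; rewrite (orients_sum_outdeg KA) (orients_sum_outdeg KB).
move=> u; apply/eqP; move: eq_sum (leAB u); rewrite (bigD1 u) // [RHS](bigD1 u) //=.
have : \sum_(i | i != u) outdeg A i <= \sum_(i | i != u) outdeg B i by apply: leq_sum.
lia.
Qed.

(** [A] and [B] have equally many arcs inside [R], so the excess of [A] over [R] comes from arcs
    leaving [R]. *)
Lemma surplus_cut (V : finType) (K A B : rel V) (R : {set V}) :
  orients K A -> orients K B ->
  (forall u, u \in R -> outdeg B u <= outdeg A u) ->
  (forall u, u \notin R -> outdeg A u <= outdeg B u) ->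
  surplus A B <= \sum_(u in R) \sum_(v in ~: R) A u v.
Proof.
move=> KA KB geR leR.
have splitR (F : rel V) : \sum_(u in R) outdeg F u =
    \sum_(u in R) \sum_(v in R) F u v + \sum_(u in R) \sum_(v in ~: R) F u v.
  rewrite -big_split; apply: eq_bigr => u _; rewrite /outdeg (bigID [in R]) /=.
  by congr addn; apply: eq_bigl => v; rewrite inE.
have inner : \sum_(u in R) \sum_(v in R) A u v = \sum_(u in R) \sum_(v in R) B u v.
  by apply: double_inj; rewrite (orients_inner_sum R KA) (orients_inner_sum R KB).
have -> : surplus A B = \sum_(u in R) (outdeg A u - outdeg B u).
  rewrite /surplus (bigID [in R]) /= [X in _ + X]big1 ?addn0 // => u /leR.
  by rewrite -subn_eq0 => /eqP.
have : \sum_(u in R) (outdeg A u - outdeg B u) + \sum_(u in R) outdeg B u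
    = \sum_(u in R) outdeg A u.
  by rewrite -big_split; apply: eq_bigr => u /geR le; rewrite /= subnK.
rewrite !splitR; lia.
Qed.

Lemma leq_add_of_sqr (a m p q : nat) : a * a <= 4 * m -> m <= p * q -> a <= p + q.
Proof.
move=> am mpq; have [AGM _] := nat_AGM2 p q.
by rewrite -leq_sqr -mulnn (leq_trans am) // (leq_trans _ AGM) // leq_pmul2l.
Qed.

(** * Breadth-first layers and short augmenting paths *)

Section Levels.
Variables (V : finType) (A B : rel V).

Definition sources : {set V} := [set u | outdeg B u < outdeg A u].

(** The ball of vertices reached from a surplus vertex by fewer than [k] arcs. Starting from [set0]
    makes every layer, the first included, a difference of consecutive levels. *)
Fixpoint level (k : nat) : {set V} :=
  if k is k'.+1
  then sources :|: level k' :|: [set v | [exists u in level k', A u v]]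
  else set0.

Lemma level_mono k : level k \subset level k.+1.
Proof. by apply/subsetP => v v_k /=; rewrite !inE v_k orbT. Qed.

Lemma level_step k u v : u \in level k -> A u v -> v \in level k.+1.
Proof.
move=> u_k Auv; rewrite /= in_setU; apply/orP; right.
by rewrite inE; apply/existsP; exists u; rewrite u_k.
Qed.

Lemma level_path k v : v \in level k ->
  exists s p, [/\ s \in sources, path A s p, last s p = v & size p < k].
Proof.
elim: k v => [|k IHk] v /=; first by rewrite inE.
rewrite !in_setU inE => /orP[/orP[Sv|/IHk[s [p [Ss Ap lp sz]]]]|].
- by exists v, [::]; rewrite Sv.
- by exists s, p; split=> //; apply: ltnW.
case/existsP => u /andP[/IHk[s [p [Ss Ap lp sz]]] Auv].
exists s, (rcons p v); rewrite rcons_path last_rcons size_rcons Ap lp Auv.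
by split.
Qed.

(** An arc leaving [level k.+1] starts outside [level k] and ends inside [level k.+2], so the cut
    lies in a product of two consecutive layers. *)
Lemma surplus_levels (K : rel V) k :
  orients K A -> orients K B ->
  (forall u, u \in level k.+1 -> outdeg B u <= outdeg A u) ->
  surplus A B <= (#|level k.+1| - #|level k|) * (#|level k.+2| - #|level k.+1|).
Proof.
move=> KA KB geR.
have sub1 := level_mono k; have sub2 := level_mono k.+1.
apply: leq_trans (surplus_cut KA KB geR _) _.
  move=> u; rewrite /= !inE !negb_or => /andP[/andP[]].
  by rewrite -leqNgt.
rewrite -!cardsDS //.
have step1 := @level_step k; have step2 := @level_step k.+1.
move: (level k) (level k.+1) (level k.+2) {geR sub1 sub2} step1 step2.
move=> X Y Z step1 step2.
have -> : \sum_(u in Y) \sum_(v in ~: Y) A u v =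
  \sum_(u in Y :\: X) \sum_(v in Z :\: Y) A u v.
  rewrite (big_setID X) /= [X in X + _]big1 ?add0n.
    apply: eq_bigr => u; rewrite in_setD => /andP[_ u_k1].
    rewrite (big_setID (Z)) /= [X in _ + X]big1 ?addn0.
      by apply: eq_bigl => v; rewrite !in_setI !in_setD in_setC andbC.
    move=> v; rewrite in_setD => /andP[v_k2 _]; case Auv: (A u v) => //.
    by rewrite (step2 _ _ u_k1 Auv) in v_k2.
  move=> u; rewrite in_setI => /andP[_ u_k]; rewrite big1 // => v; rewrite in_setC => v_k1.
  case Auv: (A u v) => //; by rewrite (step1 _ _ u_k Auv) in v_k1.
rewrite -sum_nat_const; apply: leq_sum => u _; rewrite -sum1_card.
by apply: leq_sum => v _; case: (A u v).
Qed.

(** By AM-GM two consecutive layers have at least [a] vertices together; the layers are grouped into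
    [j.+1] disjoint pairs. *)
Lemma level_growth (K : rel V) a j :
  orients K A -> orients K B -> a * a <= 4 * surplus A B ->
  (forall u, u \in level (j.*2).+1 -> outdeg B u <= outdeg A u) ->
  j.+1 * a <= #|level (j.+1).*2|.
Proof.
move=> KA KB am; elim: j => [|j IHj] geR.
  have := leq_add_of_sqr am (surplus_levels KA KB geR).
  have := subset_leq_card (level_mono 1).
  rewrite [#|level 0|]cards0; change (1.*2) with 2; change (0.*2.+1) with 1; lia.
rewrite doubleS.
have {}IHj: j.+1 * a <= #|level j.+1.*2|.
  by apply: IHj => u u_j; apply: geR; rewrite doubleS; do 2!apply: (subsetP (level_mono _)).
have := leq_add_of_sqr am (surplus_levels KA KB geR).
have := subset_leq_card (level_mono j.+1.*2).
have := subset_leq_card (level_mono j.+1.*2.+1).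
rewrite [j.+2 * a]mulSn; lia.
Qed.

End Levels.

(** An integer stand-in for the square root: the upper bound on [a * a] drives the layer growth, the
    lower bound the cost estimate. *)
Lemma sqrt_approx m : 0 < m -> exists a, m <= a * a <= 4 * m.
Proof.
move=> m_gt0; have ex : exists a, m <= a * a by exists m; nia.
case: (ex_minnP ex) => a ma min_a; exists a; rewrite ma /=.
case: a ma min_a => [|[|a]] ma min_a; [lia | lia |].
have : a.+1 * a.+1 < m; last by nia.
by rewrite ltnNge; apply/negP => /min_a; rewrite ltnn.
Qed.

Lemma exists_short_augmenting_path (V : finType) (K A B : rel V) :
  orients K A -> orients K B -> 0 < surplus A B ->
  exists s p a, [/\ path A s p /\ uniq (s :: p), outdeg B s < outdeg A s,
    outdeg A (last s p) < outdeg B (last s p),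
    surplus A B <= a * a & size p * a <= 2 * #|V|].
Proof.
move=> KA KB m_gt0; have [a /andP[ma am]] := sqrt_approx m_gt0.
have a_gt0 : 0 < a by case: a ma am => //; lia.
(* With this [j], [j.+1 * a] exceeds [#|V|], so the layers cannot grow that far without meeting a
   deficit vertex. *)
set j := #|V| %/ a.
have : [exists u in level A B (j.*2).+1, outdeg A u < outdeg B u].
  apply: contraT; rewrite negb_exists_in => /forall_inP no_sink.
  have : j.+1 * a <= #|level A B j.+1.*2|.
    by apply: (level_growth KA KB am) => u /no_sink; rewrite -leqNgt.
  have := max_card (level A B j.+1.*2); have := ltn_ceil #|V| a_gt0.
  rewrite -/j; lia.
case/exists_inP => t /level_path[s [p [Ss Ap <- sz]]] sink.
move: sink; case/shortenP: Ap => q Aq uniq_q sub_q sink.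
exists s, q, a; split=> //; first by move: Ss; rewrite inE.
have q_le : size q <= 2 * j.
  rewrite mul2n -ltnS; apply: leq_ltn_trans sz.
  by apply: uniq_leq_size sub_q; case/andP: uniq_q.
rewrite (leq_trans (leq_mul q_le (leqnn a))) // -mulnA leq_mul2l /=.
exact: leq_divM.
Qed.

(** Inductive step for summing path lengths: [l] is the length of the path reversed at surplus
    [m.+1], at most [2 * N / sqrt m.+1], and [c] is the cost of all later reversals. *)
Lemma sqrt_step (c l a N m : nat) :
  m.+1 <= a * a -> l * a <= 2 * N -> (INR c <= 4 * INR N * sqrt (INR m))%R ->
  (INR (l + c) <= 4 * INR N * sqrt (INR m.+1))%R.
Proof.
move=> ma la cm.
have sm_ge0 := sqrt_pos (INR m); have sm1_ge0 := sqrt_pos (INR m.+1).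
have sm := sqrt_sqrt _ (pos_INR m); have sm1 := sqrt_sqrt _ (pos_INR m.+1).
have l_ge0 := pos_INR l; have N_ge0 := pos_INR N; have a_ge0 := pos_INR a.
have m_ge0 := pos_INR m.
have {}ma : (INR m.+1 <= INR a * INR a)%R by rewrite -mult_INR; apply: le_INR; apply/leP.
have {}la : (INR l * INR a <= 2 * INR N)%R.
  have -> : 2%R = INR 2 by [].
  by rewrite -!mult_INR; apply: le_INR; apply/leP.
have mS := S_INR m; rewrite plus_INR.
move: (sqrt (INR m)) (sqrt (INR m.+1)) sm_ge0 sm1_ge0 sm sm1 cm => x y x0 y0 xx yy cm.
have ya : (y <= INR a)%R by apply: Rsqr_incr_0_var => //; rewrite /Rsqr; lra.
have y_gt0 : (0 < y)%R by case: y0 => // y0; rewrite -y0 in yy; lra.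
have ly : (INR l * y <= 2 * INR N)%R.
  by apply: Rle_trans la; apply: Rmult_le_compat_l.
have xy : (x <= y)%R by apply: Rsqr_incr_0_var => //; rewrite /Rsqr; lra.
(* [1 = (y - x) * (y + x) <= 2 y (y - x)], where [y - x] is the increment of the square root *)
have key : (1 <= 2 * y * (y - x))%R by nra.
suff : (INR l <= 4 * INR N * (y - x))%R by lra.
have : (INR l * 1 <= INR l * (2 * y * (y - x)))%R by apply: Rmult_le_compat_l.
have : (INR l * y * (2 * (y - x)) <= 2 * INR N * (2 * (y - x)))%R.
  by apply: Rmult_le_compat_r ly; lra.
lra.
Qed.

Lemma realize_outdegrees (V : finType) (K A B : rel V) :
  orients K A -> orients K B ->
  exists A' : rel V, [/\ orients K A', outdeg A' =1 outdeg B &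
    (INR (arc_diff A A') <= 4 * INR #|V| * sqrt (INR (surplus A B)))%R].
Proof.
move=> KA KB; move Em: (surplus A B) => m.
elim: m A KA Em => [|m IHm] A KA Em.
  exists A; split=> //; first exact: surplus0 Em.
  rewrite /arc_diff big1 => [|u _]; last by rewrite big1 // => v _; rewrite andbN.
  by rewrite /= sqrt_0; lra.
have [|s [p [a [[Ap uniq_p] Ss St ma la]]]] := exists_short_augmenting_path KA KB.
  by rewrite Em.
have [A1 [KA1 dA1 oA1]] := reverse_path KA Ap uniq_p.
have [|A' [KA' oA' dA']] := IHm A1 KA1.
  (* Only the term at [s] drops, by one; at the deficit end the truncated difference is 0 before and
     after. *)
  apply: succn_inj; rewrite -Em /surplus (bigD1 s) // [RHS](bigD1 s) //= -addSn.
  congr addn.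
    have := oA1 s; rewrite eqxx; case: eqVneq => [e|_]; last lia.
    by move: St; rewrite -e; lia.
  apply: eq_bigr => u /negbTE us; have := oA1 u; rewrite us.
  by case: eqVneq => [->|_]; lia.
exists A'; split=> //; rewrite Em in ma.
apply: Rle_trans (sqrt_step ma la dA'); apply: le_INR; apply/leP.
by apply: leq_trans (arc_diff_triangle _ A1 _) _; rewrite leq_add2r.
Qed.

(** * Symmetrizing a balanced relation *)

Lemma even_set_involution (V : finType) (Z : {set V}) :
  ~~ odd #|Z| ->
  exists mu : V -> V, forall v, v \in Z -> [/\ mu v \in Z, mu v != v & mu (mu v) = v].
Proof.
move Em: #|Z| => m; elim/ltn_ind: m Z Em => m IHm Z Em.
case: (set_0Vmem Z) => [->|[x Zx]]; first by exists (fun v => v) => v; rewrite inE.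
have := cardsD1 x Z; rewrite Zx => EZ m_even.
case: (set_0Vmem (Z :\ x)) => [Z0|[y Zy]].
  by move: m_even; rewrite -Em EZ Z0 cards0.
have := cardsD1 y (Z :\ x); rewrite Zy => EZx.
case: (IHm #|Z :\ x :\ y| _ _ erefl) => [||mu mu_inv].
- by lia.
- by move: m_even; rewrite -Em EZ EZx /= negbK.
move: Zy; rewrite !inE => /andP[yx Zy].
exists (fun v => if v == x then y else if v == y then x else mu v) => v Zv.
case: (eqVneq v x) => [->|vx]; first by rewrite Zy yx eqxx (negbTE yx).
case: (eqVneq v y) => [->|vy]; first by rewrite Zx (eq_sym x) yx eqxx.
have := mu_inv v; rewrite !inE vx vy Zv => /(_ isT)[/and3P[muy mux Zmu] muv mumu].
by rewrite (negbTE mux) (negbTE muy) Zmu.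
Qed.

(** * Closed trails of a balanced digraph *)

Section BalancedDigraph.
Variables (T V : finType) (src tgt : T -> V).
Hypothesis balanced : forall v, #|[set t | src t == v]| = #|[set t | tgt t == v]|.

(** At each vertex the i-th incoming arc is followed by the i-th outgoing one. The cycles of the
    permutation are closed trails. *)
Lemma exists_successor_perm : exists s : {perm T}, forall t, src (s t) = tgt t.
Proof.
pose outs v := enum [set t | src t == v]; pose ins v := enum [set t | tgt t == v].
pose f t := nth t (outs (tgt t)) (index t (ins (tgt t))).
have idx t : index t (ins (tgt t)) < size (outs (tgt t)).
  by rewrite -cardE balanced cardE index_mem mem_enum inE.
have src_f t : src (f t) = tgt t.
  by apply/eqP; have := mem_nth t (idx t); rewrite mem_enum inE.
have f_inj : injective f.
  move=> t1 t2 eq_f; have eq_tgt : tgt t1 = tgt t2 by rewrite -!src_f eq_f.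
  have i1 := idx t1; have i2 := idx t2.
  move/eqP: eq_f; rewrite /f (set_nth_default t2 t1 i1); rewrite eq_tgt in i1 *.
  rewrite nth_uniq ?enum_uniq // => /eqP eq_idx.
  have in2 : t2 \in ins (tgt t2) by rewrite mem_enum inE.
  have in1 : t1 \in ins (tgt t2) by rewrite mem_enum inE eq_tgt.
  by rewrite -(nth_index t1 in1) eq_idx nth_index.
by exists (perm f_inj) => t; rewrite permE.
Qed.

(** A successor permutation with the fewest orbits works: two trails through a common vertex could
    otherwise be merged. *)
Lemma exists_euler_perm : exists s : {perm T},
  (forall t, src (s t) = tgt t) /\ (forall x y, src x = src y -> fconnect s x y).
Proof.
have [s0 src_s0] := exists_successor_perm.
pose good m := [exists s : {perm T}, [forall t, src (s t) == tgt t] && (#|porbits s| == m)].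
have ex : exists m, good m.
  exists #|porbits s0|; apply/existsP; exists s0; rewrite eqxx andbT.
  by apply/forallP => t; rewrite src_s0.
case: (ex_minnP ex) => m /existsP[s /andP[/forallP src_s /eqP orb_s]] min_m.
exists s; split=> [t|x y eq_src]; first exact/eqP.
suff: y \in porbit s x by case/porbitP => i ->; rewrite permX fconnect_iter.
apply: contraT => xy; have neq_xy : y != x.
  by apply: contraNneq xy => ->; exact: porbit_id.
(* splicing two closed trails through a common vertex merges them *)
have := porbits_mul_tperm s^-1 y x; rewrite /= porbitV xy neq_xy (porbitsV s).
(* Inverting turns the product into [s * tperm y x], which swaps two arcs with the same source after
   [s] and so is still a successor permutation. *)
rewrite -(porbitsV (tperm y x * s^-1)%g) invMg invgK tpermV.
suff /min_m : good #|porbits (s * tperm y x)%g| by rewrite orb_s addn1 addn2 => m_le [Em]; rewrite -Em ltnn in m_le.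
apply/existsP; exists (s * tperm y x)%g; rewrite eqxx andbT; apply/forallP => t.
rewrite -(eqP (src_s t)) permM; case: tpermP => [->|->|//]; by rewrite eq_src.
Qed.

(* The vertices in [Z] carry the parity defects of the closed trails of odd length;
   the sign of each defect can be prescribed. *)
Lemma balanced_signs : exists Z : {set V},
  [/\ odd #|Z| = odd #|T|, #|Z| <= #|T|,
      forall t, src t \in Z -> tgt t \in Z -> src t = tgt t &
      forall eps : V -> bool, exists pos : T -> bool, forall v,
        \sum_(t | src t == v) pos t + \sum_(t | tgt t == v) pos t + (v \in Z) * ~~ eps v
        = #|[set t | tgt t == v]| + (v \in Z) * eps v].
Proof.
have [s [src_s conn_s]] := exists_euler_perm.
have symf := fconnect_sym (@perm_inj _ s).
have root_s t : froot s (s t) = froot s t.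
  by apply/eqP; rewrite root_connect // symf fconnect1.
(* [o] selects one arc, the root, on each trail of odd length; the defect is placed at its
   source. *)
pose o t := (froot s t == t) && odd (fingraph.order s t).
have o_uniq t1 t2 : o t1 -> o t2 -> src t1 = src t2 -> t1 = t2.
  move=> /andP[/eqP<- _] /andP[/eqP<- _] /conn_s.
  by rewrite -(root_connect symf) !root_root // => /eqP.
pose Z := src @: [set t | o t].
have sumZ v : \sum_(t | src t == v) o t = (v \in Z).
  case: imsetP => [[t]|noZ].
    rewrite inE => ot ->; rewrite (bigD1 t) //= ot big1 // => u /andP[/eqP eq_src ut].
    by case ou: (o u) => //; case/eqP: ut; apply: o_uniq.
  rewrite big1 // => t /eqP eq_src; case ot: (o t) => //; case: noZ.
  by exists t; rewrite ?inE.
have signs (eps : V -> bool) : exists pos : T -> bool, forall v,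
    \sum_(t | src t == v) pos t + \sum_(t | tgt t == v) pos t + (v \in Z) * ~~ eps v
    = #|[set t | tgt t == v]| + (v \in Z) * eps v.
  (* Signs alternate along a trail from its root, where [eps] fixes the first one. The alternation
     fails only when an odd trail closes up at its root. *)
  pose pos t := odd (findex s (froot s t) t) (+) eps (src (froot s t)).
  exists pos => v.
  have reidx (F : T -> nat) : \sum_(t | src t == v) F t = \sum_(t | tgt t == v) F (s t).
    rewrite (reindex_inj (@perm_inj _ s)) /=; apply: eq_bigl => t.
    by rewrite src_s.
  have step t : pos t + pos (s t) + o (s t) * ~~ eps (tgt t) = 1 + o (s t) * eps (tgt t).
    rewrite /pos /o root_s; set r := froot s t.
    have rt : fconnect s r t by rewrite symf connect_root.
    have itk := iter_findex rt; have := findex_max rt; set k := findex s r t in itk *.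
    rewrite leq_eqVlt => /predU1P[Ek|lt_k].
      have -> : s t = r by rewrite -{1}itk -iterS Ek iter_order //; exact: perm_inj.
      rewrite findex0 eqxx -src_s.
      have -> : s t = r by rewrite -{1}itk -iterS Ek iter_order //; exact: perm_inj.
      rewrite -Ek /=; by case: (odd k) (eps _) => [] [].
    have st : s t = iter k.+1 s r by rewrite iterS itk.
    have fk : findex s r (s t) = k.+1 by rewrite st findex_iter.
    have -> : (r == s t) = false by rewrite -(findex_eq0 s) fk.
    by rewrite fk /=; case: (odd k) (eps _) => [] [].
  rewrite -sumZ !reidx !big_distrl /= -sum1_card addnC addnA -!big_split /=.
  have -> : \sum_(t in [set t | tgt t == v]) 1 = \sum_(t | tgt t == v) 1.
    by apply: eq_bigl => t; rewrite inE.
  rewrite -big_split; apply: eq_bigr => t /eqP <-; have := step t => /=; lia.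
exists Z; split=> //.
(* Summed over all vertices, each [pos t] counts twice, so [#|Z|] and [#|T|] have the same
   parity. *)
- have [pos pos_sum] := signs (fun _ => false).
  have : \sum_v (\sum_(t | src t == v) pos t + \sum_(t | tgt t == v) pos t + (v \in Z))
      = \sum_v #|[set t | tgt t == v]|.
    by apply: eq_bigr => v _; have := pos_sum v; rewrite muln1 muln0 addn0.
  have part (f : T -> V) (F : T -> nat) : \sum_v \sum_(t | f t == v) F t = \sum_t F t.
    by rewrite [RHS](partition_big f predT).
  have -> : \sum_v #|[set t | tgt t == v]| = #|T|.
    rewrite -sum1_card -(part tgt); apply: eq_bigr => v _; rewrite -sum1_card.
    by apply: eq_bigl => t; rewrite inE.
  rewrite !big_split /= !part addnn => <-; rewrite oddD odd_double /=.
  by rewrite -sum1_card big_mkcond.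
- exact: leq_trans (leq_imset_card _ _) (max_card _).
(* [t] and its successor [s t] lie on one trail, which has a single root, so both ends of [t] are
   the source of that root. *)
- move=> t /imsetP[r1]; rewrite inE => o1 e1 /imsetP[r2]; rewrite inE => o2 e2.
  have c1 := conn_s _ _ e1; have c2 : fconnect s (s t) r2 by apply: conn_s; rewrite src_s.
  rewrite e1 e2; congr src; have /andP[/eqP<- _] := o1; have /andP[/eqP<- _] := o2.
  apply/eqP; rewrite root_connect // symf.
  apply: connect_trans c1; rewrite symf; apply: connect_trans c2; exact: fconnect1.
Qed.

End BalancedDigraph.

Lemma symmetric_sum_even (V : finType) (g : rel V) :
  symmetric g -> irreflexive g -> ~~ odd (\sum_u \sum_v g u v).
Proof.
move=> g_sym g_irr.
have -> : \sum_u \sum_v g u v = \sum_u \sum_v (g u v && (enum_rank u < enum_rank v))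
    + \sum_v \sum_u (g u v && (enum_rank v < enum_rank u)).
  rewrite [X in _ + X]exchange_big -big_split; apply: eq_bigr => u _.
  rewrite -big_split; apply: eq_bigr => v _ /=.
  case: ltngtP => [||/ord_inj/enum_rank_inj->]; rewrite ?andbT ?andbF ?addn0 //.
  by rewrite g_irr.
have -> : \sum_v \sum_u (g u v && (enum_rank v < enum_rank u)) =
    \sum_u \sum_v (g u v && (enum_rank u < enum_rank v)).
  by apply: eq_bigr => u _; apply: eq_bigr => v _; rewrite g_sym.
by rewrite addnn odd_double.
Qed.

Section Symmetrize.
Variables (V : finType) (M : rel V).
Hypothesis balancedM : forall u, \sum_v M u v = \sum_v M v u.
Hypothesis evenM : ~~ odd (\sum_u \sum_v M u v).

Definition one_way : pred (V * V) := fun e => M e.1 e.2 && ~~ M e.2 e.1.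
Local Notation T := {e : V * V | e \in one_way}.

Lemma one_way_sum_src u (F : V * V -> nat) :
  \sum_(t : T | (val t).1 == u) F (val t) = \sum_v one_way (u, v) * F (u, v).
Proof.
rewrite -(big_sub_cond one_way (fun e => e.1 == u) F) big_mkcond /=.
pose G a b := if ((a, b) \in one_way) && (a == u) then F (a, b) else 0.
transitivity (\sum_e G e.1 e.2); first by apply: eq_bigr => -[a b].
rewrite -(pair_bigA _ G) /= /G (bigD1 u) //=.
rewrite [X in _ + X]big1 ?addn0 => [|a /negbTE->]; last by rewrite big1 // => b; rewrite andbF.
by apply: eq_bigr => v _; rewrite eqxx andbT unfold_in; rewrite /one_way /=; case: (_ && _); rewrite ?mul1n ?mul0n.
Qed.

Lemma one_way_sum_tgt u (F : V * V -> nat) :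
  \sum_(t : T | (val t).2 == u) F (val t) = \sum_v one_way (v, u) * F (v, u).
Proof.
rewrite -(big_sub_cond one_way (fun e => e.2 == u) F) big_mkcond /=.
pose G a b := if ((a, b) \in one_way) && (b == u) then F (a, b) else 0.
transitivity (\sum_e G e.1 e.2); first by apply: eq_bigr => -[a b].
rewrite -(pair_bigA _ G) /= /G.
apply: eq_bigr => v _; rewrite (bigD1 u) //= eqxx andbT unfold_in.
rewrite big1 ?addn0 => [|b /negbTE->]; last by rewrite andbF.
by rewrite /one_way /=; case: (_ && _); rewrite ?mul1n ?mul0n.
Qed.

Lemma sum_one_way u : \sum_v M u v = \sum_v (M u v && M v u) + \sum_v one_way (u, v).
Proof.
rewrite -big_split; apply: eq_bigr => v _; rewrite /one_way /=.
by case: (M u v) (M v u) => [] [].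
Qed.

Lemma sum_one_way_rev u : \sum_v M v u = \sum_v (M u v && M v u) + \sum_v one_way (v, u).
Proof.
rewrite -big_split; apply: eq_bigr => v _; rewrite /one_way /=.
by case: (M u v) (M v u) => [] [].
Qed.

Lemma one_way_balanced u :
  #|[set t : T | (val t).1 == u]| = #|[set t : T | (val t).2 == u]|.
Proof.
have to_sum (P : pred T) : #|[set t | P t]| = \sum_(t | P t) 1.
  by rewrite -sum1_card; apply: eq_bigl => t; rewrite inE.
rewrite !to_sum (one_way_sum_src u (fun=> 1)) (one_way_sum_tgt u (fun=> 1)).
have := balancedM u; rewrite sum_one_way sum_one_way_rev => /addnI.
by move=> eq_sum; under eq_bigr do rewrite muln1; under [RHS]eq_bigr do rewrite muln1.
Qed.

Lemma symmetrize : irreflexive M -> exists g : rel V,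
  [/\ symmetric g, irreflexive g, forall u, \sum_v g u v = \sum_v M u v &
      \sum_u \sum_v (g u v != M u v) <= 2 * \sum_u \sum_v (M u v != M v u)].
Proof.
move=> M_irr.
have [Z [parZ leZ sepZ signs]] := balanced_signs one_way_balanced.
have part (F : V -> T -> nat) (f : T -> V) : \sum_v \sum_(t | f t == v) F v t = \sum_t F (f t) t.
  rewrite [RHS](partition_big f predT) //; apply: eq_bigr => v _.
  by apply: eq_bigr => t /eqP->.
have cardT : #|{: T}| = \sum_u \sum_v one_way (u, v).
  rewrite -sum1_card -(part (fun _ _ => 1) (fun t => (val t).1)).
  apply: eq_bigr => u _; rewrite (one_way_sum_src u (fun=> 1)).
  by apply: eq_bigr => v _; rewrite muln1.
(* The total of [M] is even and so is its number of two-way pairs; hence the one-way pairs are even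
   in number. *)
have evenZ : ~~ odd #|Z|.
  have := evenM; rewrite parZ cardT; under eq_bigr do rewrite sum_one_way.
  rewrite big_split oddD /=.
  rewrite (negbTE (symmetric_sum_even (g := fun u v => M u v && M v u) _ _)) //.
    by move=> u v; rewrite andbC.
  by move=> u; rewrite M_irr.
have [mu mu_inv] := even_set_involution evenZ.
(* The error at [u] is +1 when the pair with its partner is present, so that flipping removes it,
   and -1 when flipping adds it. *)
have [pos pos_sum] := signs (fun u => M u (mu u)).
pose pos' e := if insub e is Some t then pos t else false.
have pos'_val t : pos' (val t) = pos t by rewrite /pos' valK.
have pos'_one_way e : pos' e -> one_way e.
  by rewrite /pos'; case: insubP => // t; rewrite unfold_in.
pose z u v := (u \in Z) && (v == mu u).
have z_sym : symmetric z.
  by move=> u v; apply/andP/andP => -[/mu_inv[Zmu _ mumu] /eqP->]; rewrite mumu.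
have z_neq u v : z u v -> u != v by case/andP => /mu_inv[_ neq _] /eqP->; rewrite eq_sym.
(* A one-way pair inside [Z] would have equal ends by [sepZ]; so matched pairs are symmetric in [M]
   and flipping them preserves symmetry. *)
have z_M u v : z u v -> M u v = M v u.
  have sep a b : z a b -> M a b -> M b a.
    move=> zab Mab; apply: contraT => Mba.
    have ow : (a, b) \in one_way by rewrite unfold_in /one_way /= Mab.
    have := sepZ (Sub (a, b) ow); rewrite /= => sepab.
    have Za : a \in Z by case/andP: zab.
    have Zb : b \in Z by rewrite z_sym in zab; case/andP: zab.
    by have := z_neq _ _ zab; rewrite (sepab Za Zb) eqxx.
  by move=> zuv; apply/idP/idP; apply: sep; rewrite // z_sym.
pose g u v := if M u v == M v u then M u v (+) z u v else pos' (u, v) || pos' (v, u).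
(* Removed pairs are added back on the left, which avoids subtraction and matches the form of
   [pos_sum] after summing. *)
have g_deg u v : g u v + z u v * M u v =
    (M u v && M v u) + one_way (u, v) * pos' (u, v) + one_way (v, u) * pos' (v, u)
    + z u v * ~~ M u v.
  have := z_M u v; have := pos'_one_way (u, v); have := pos'_one_way (v, u).
  rewrite /g /one_way /=; case: (M u v) (M v u) (z u v) (pos' _) (pos' _) => [] [] [] [] [] //=;
  by do ?[move/(_ isT) => // | move=> _].
exists g; split.
- move=> u v; rewrite /g eq_sym orbC z_sym.
  by case: eqP => // ->.
- move=> u; rewrite /g eqxx M_irr /=; apply: contraTF isT => /z_neq.
  by rewrite eqxx.
- move=> u.
  have sum_z (P : V -> bool) : \sum_v z u v * P v = (u \in Z) * P (mu u).
    rewrite (bigD1 (mu u)) //= /z eqxx andbT big1 ?addn0 // => v /negbTE->.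
    by rewrite andbF.
  have : \sum_v (g u v + z u v * M u v) = \sum_v
      ((M u v && M v u) + one_way (u, v) * pos' (u, v)
       + one_way (v, u) * pos' (v, u) + z u v * ~~ M u v).
    by apply: eq_bigr => v _; exact: g_deg.
  rewrite !big_split /=.
  rewrite -(one_way_sum_src u pos') -(one_way_sum_tgt u pos').
  rewrite (sum_z (M u)) (sum_z (fun v => ~~ M u v)).
  under [\sum_(t | (val t).1 == u) _]eq_bigr do rewrite pos'_val.
  under [\sum_(t | (val t).2 == u) _]eq_bigr do rewrite pos'_val.
  have := pos_sum u; rewrite balancedM sum_one_way_rev.
  have -> : #|[set t : T | (val t).2 == u]| = \sum_v one_way (v, u).
    rewrite -sum1_card (eq_bigl (fun t : T => (val t).2 == u)) => [|t]; last by rewrite inE.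
    by rewrite (one_way_sum_tgt u (fun=> 1)); apply: eq_bigr => v _; rewrite muln1.
  move=> pos_u deg_u; apply: (@addIn ((u \in Z) * M u (mu u))).
  by rewrite deg_u -[RHS]addnA -pos_u !addnA.
(* Changes occur at one-way pairs, in both orders, and at matched pairs: at most [3 * #|T|] entries,
   while the asymmetry of [M] counts [2 * #|T|]. *)
have le_pt u v : (g u v != M u v) <= one_way (u, v) + one_way (v, u) + z u v.
  rewrite /g /one_way /=; case: (M u v) (M v u) (z u v) (pos' _) (pos' _) => [] [] [] [] [] //.
apply: leq_trans (leq_sum _ (fun u _ => leq_sum _ (fun v _ => le_pt u v))) _.
under eq_bigr do rewrite !big_split /=; rewrite !big_split /=.
have -> : \sum_u \sum_v (M u v != M v u) =
    \sum_u \sum_v one_way (u, v) + \sum_u \sum_v one_way (v, u).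
  rewrite -big_split; apply: eq_bigr => u _; rewrite -big_split; apply: eq_bigr => v _.
  by rewrite /one_way /=; case: (M u v) (M v u) => [] [].
have -> : \sum_u \sum_v z u v = #|Z|.
  rewrite -sum1_card [RHS]big_mkcond; apply: eq_bigr => u _.
  rewrite (bigD1 (mu u)) //= /z eqxx andbT big1 => [|v /negbTE->]; last by rewrite andbF.
  by case: (u \in Z).
by move: leZ; rewrite cardT; lia.
Qed.

End Symmetrize.

(** * Degree sequences of graphs *)

Section DoubleCover.
Variable V : finType.
Implicit Types (g : rel V) (A : rel (V * bool)).

Definition cover_edge : rel (V * bool) :=
  fun u v => (u.1 != v.1) && (u.2 != v.2).

Definition cover_orientation g : rel (V * bool) := fun u v =>
  if v.2 then ~~ u.2 && g u.1 v.1
  else [&& u.2, u.1 != v.1 & ~~ g v.1 u.1].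

Lemma cover_orientationP g : irreflexive g -> orients cover_edge (cover_orientation g).
Proof.
move=> g_irr [u a] [v b]; rewrite /cover_edge /cover_orientation /=.
by case: eqVneq => [<-|]; rewrite ?g_irr; case: a b (g u v) (g v u) => [] [] [] [].
Qed.

(** Orientations of the cover are the 0/1 matrices with zero diagonal, symmetric or not. *)
Lemma orients_cover A : orients cover_edge A ->
  exists2 g, irreflexive g & A =2 cover_orientation g.
Proof.
move=> KA; exists (fun u v => A (u, false) (v, true)).
  move=> u; have := KA (u, false) (u, true); rewrite /cover_edge /= eqxx.
  by case: (A _ _).
move=> [u a] [v b]; rewrite /cover_orientation /=; have := KA (u, a) (v, b).
rewrite /cover_edge /=; case: a b => [] [] /=; rewrite ?andbF ?andbT //;
  by case: (A _ _) (A _ _) (u != v) => [] [] [].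
Qed.

Lemma sum_cover (F : V * bool -> nat) :
  \sum_v F v = \sum_v F (v, false) + \sum_v F (v, true).
Proof.
transitivity (\sum_v \sum_b F (v, b)).
  by rewrite pair_bigA; apply: eq_bigr => -[].
by rewrite -big_split; apply: eq_bigr => v _; rewrite big_bool /= addnC.
Qed.

Lemma outdeg_cover_false g u : outdeg (cover_orientation g) (u, false) = \sum_v g u v.
Proof. by rewrite /outdeg sum_cover big1. Qed.

Lemma outdeg_cover_true g u : irreflexive g ->
  outdeg (cover_orientation g) (u, true) + \sum_v g v u = \sum_v (u != v).
Proof.
move=> g_irr; rewrite /outdeg sum_cover [X in _ + X + _]big1 // addn0 -big_split.
apply: eq_bigr => v _; rewrite /cover_orientation /=.
by case: eqVneq => [<-|_]; rewrite ?g_irr //; case: (g v u).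
Qed.

(** The copy [(u, false)] records an excess of degree and [(u, true)] a shortage; the two truncated
    differences add up to the absolute one. *)
Lemma surplus_cover g h : symmetric g -> symmetric h -> irreflexive g -> irreflexive h ->
  surplus (cover_orientation g) (cover_orientation h)
  = \sum_u absdiff (\sum_v g u v) (\sum_v h u v).
Proof.
move=> g_sym h_sym g_irr h_irr; rewrite /surplus sum_cover -big_split.
apply: eq_bigr => u _; rewrite /absdiff /= !outdeg_cover_false.
have := outdeg_cover_true u g_irr; have := outdeg_cover_true u h_irr.
rewrite (eq_bigr (fun v => h u v : nat)) => [|v _]; last by rewrite h_sym.
rewrite [X in _ -> _ + X = _ -> _](eq_bigr (fun v => g u v : nat)) => [|v _];
  last by rewrite g_sym.
lia.
Qed.

Lemma arc_diff_cover g h : irreflexive g -> irreflexive h ->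
  arc_diff (cover_orientation g) (cover_orientation h) = \sum_u \sum_v (g u v != h u v).
Proof.
move=> g_irr h_irr; rewrite /arc_diff sum_cover.
have -> : \sum_u \sum_v (g u v != h u v)
    = \sum_u \sum_v (g u v && ~~ h u v) + \sum_v \sum_u (h u v && ~~ g u v).
  rewrite [X in _ + X]exchange_big -big_split; apply: eq_bigr => u _.
  by rewrite -big_split; apply: eq_bigr => v _; case: (g u v) (h u v) => [] [].
congr addn; apply: eq_bigr => u _; rewrite sum_cover.
  by rewrite [X in X + _]big1.
rewrite [X in _ + X]big1 // addn0; apply: eq_bigr => v _.
rewrite /cover_orientation /=; case: eqVneq => [<-|_]; first by rewrite g_irr h_irr.
by case: (g v u) (h v u) => [] [].
Qed.

End DoubleCover.

Lemma realize_degrees (V : finType) (g h : rel V) :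
  symmetric g -> symmetric h -> irreflexive g -> irreflexive h ->
  exists g' : rel V, [/\ symmetric g', irreflexive g',
    forall u, \sum_v g' u v = \sum_v h u v &
    (INR (\sum_u \sum_v (g' u v != g u v)) <=
      40 * INR #|V| * sqrt (INR (\sum_u absdiff (\sum_v g u v) (\sum_v h u v))))%R].
Proof.
move=> g_sym h_sym g_irr h_irr.
have [A [KA oA dA]] :=
  realize_outdegrees (cover_orientationP g_irr) (cover_orientationP h_irr).
have [M M_irr eqAM] := orients_cover KA.
have oM u : outdeg (cover_orientation M) u = outdeg (cover_orientation h) u.
  by rewrite -oA; apply: eq_bigr => v _; rewrite eqAM.
have rowM u : \sum_v M u v = \sum_v h u v.
  by rewrite -!outdeg_cover_false oM.
have colM u : \sum_v M v u = \sum_v h u v.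
  have := outdeg_cover_true u M_irr; rewrite oM -(outdeg_cover_true u h_irr) => /addnI->.
  by apply: eq_bigr => v _; rewrite h_sym.
have evenM : ~~ odd (\sum_u \sum_v M u v).
  by rewrite (eq_bigr _ (fun u _ => rowM u)) symmetric_sum_even.
have balM u : \sum_v M u v = \sum_v M v u by rewrite rowM colM.
have [g' [g'_sym g'_irr deg_g' dist_g']] := symmetrize balM evenM M_irr.
exists g'; split=> // [u|]; first by rewrite deg_g' rowM.
move: dA; rewrite surplus_cover // card_prod card_bool.
have -> : arc_diff (cover_orientation g) A = \sum_u \sum_v (g u v != M u v).
  rewrite -arc_diff_cover //; apply: eq_bigr => u _; apply: eq_bigr => v _.
  by rewrite eqAM.
have -> : INR (#|V| * 2) = (2 * INR #|V|)%R by rewrite mult_INR Rmult_comm.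
set x := \sum_u \sum_v (g u v != M u v) => dA.
(* As [g] is symmetric, an asymmetric pair of [M] differs from [g] in one of its two entries. *)
have asym : \sum_u \sum_v (M u v != M v u) <= 2 * x.
  rewrite mul2n -addnn {2}/x [X in _ <= _ + X]exchange_big -big_split; apply: leq_sum => u _.
  rewrite -big_split; apply: leq_sum => v _; rewrite /= (g_sym v u).
  by case: (g u v) (M u v) (M v u) => [] [] [].
(* [M] is at distance [x] from [g] and symmetrizing costs at most [4 * x]. With [x] at most 8 times
   [#|V|] times the root, this gives 40. *)
have : \sum_u \sum_v (g' u v != g u v) <= 5 * x.
  have : \sum_u \sum_v (g' u v != g u v) <= \sum_u \sum_v (g' u v != M u v) + x.
    rewrite -big_split; apply: leq_sum => u _; rewrite -big_split; apply: leq_sum => v _.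
    by case: (g' u v) (g u v) (M u v) => [] [] [].
  lia.
move/leP/le_INR; rewrite mult_INR; have -> : INR 5 = 5%R by rewrite /=; ring.
lra.
Qed.

(** * Edge sets and adjacency relations *)

Definition adjacency (n : nat) (G : {set {set 'I_n}}) : rel 'I_n :=
  fun i j => (i != j) && ([set i; j] \in G).

Definition edge_set (n : nat) (g : rel 'I_n) : {set {set 'I_n}} :=
  [set [set e.1; e.2] | e : 'I_n * 'I_n & g e.1 e.2].

Lemma adjacency_sym n (G : {set {set 'I_n}}) : symmetric (adjacency G).
Proof. by move=> i j; rewrite /adjacency eq_sym setUC. Qed.

Lemma adjacency_irr n (G : {set {set 'I_n}}) : irreflexive (adjacency G).
Proof. by move=> i; rewrite /adjacency eqxx. Qed.

Lemma set2_inj n (i j k : 'I_n) : [set i; j] = [set i; k] -> j = k.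
Proof.
move=> eq_set; have : j \in [set i; k] by rewrite -eq_set set22.
have : k \in [set i; j] by rewrite eq_set set22.
by rewrite !inE => /orP[]/eqP-> // /orP[]/eqP.
Qed.

Lemma deg_adjacency n (G : {set {set 'I_n}}) i :
  is_graph G -> deg G i = \sum_j adjacency G i j.
Proof.
move=> grG; have -> : \sum_j adjacency G i j = #|[set j | adjacency G i j]|.
  rewrite -sum1_card [RHS]big_mkcond; apply: eq_bigr => j _ /=.
  by rewrite inE; case: adjacency.
rewrite -(card_imset _ (@set2_inj n i)); apply: eq_card => e; rewrite inE.
apply/andP/imsetP => [[Ge ie]|[j]]; last first.
  by rewrite inE => /andP[_ Gij] ->; rewrite Gij set21.
have /eqP/cards2P[a [b [neq_ab Ee]]] := grG e Ge; subst e.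
move: ie; rewrite !inE => /orP[/eqP->|/eqP->]; [exists b | exists a] => //.
  by rewrite inE /adjacency neq_ab.
by rewrite inE /adjacency eq_sym neq_ab setUC.
by rewrite setUC.
Qed.

Lemma edge_set_graph n (g : rel 'I_n) : irreflexive g -> is_graph (edge_set g).
Proof.
move=> g_irr e /imsetP[[i j]]; rewrite inE /= => gij ->; rewrite cards2.
by case: eqVneq gij => [->|//]; rewrite g_irr.
Qed.

Lemma edge_setK n (g : rel 'I_n) :
  symmetric g -> irreflexive g -> adjacency (edge_set g) =2 g.
Proof.
move=> g_sym g_irr i j; rewrite /adjacency.
case: eqVneq => [<-|neq_ij]; first by rewrite g_irr.
apply/imsetP/idP => [[[a b]]|gij]; last by exists (i, j); rewrite ?inE.
rewrite inE /= => gab eq_set; have := set21 i j; rewrite eq_set !inE.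
case/orP => /eqP Ei; subst i; first by rewrite (set2_inj eq_set).
by rewrite (setUC [set a]) in eq_set; rewrite (set2_inj eq_set) g_sym.
Qed.

Lemma symdiff_card_le n (E F : {set {set 'I_n}}) : is_graph E -> is_graph F ->
  symdiff_card E F <= \sum_i \sum_j (adjacency E i j != adjacency F i j).
Proof.
move=> grE grF.
pose D := [set e : 'I_n * 'I_n | adjacency E e.1 e.2 != adjacency F e.1 e.2].
have -> : \sum_i \sum_j (adjacency E i j != adjacency F i j) = #|D|.
  rewrite -sum1_card [RHS]big_mkcond pair_bigA; apply: eq_bigr => -[i j] _ /=.
  by rewrite inE /=; case: (_ != _).
apply: leq_trans (leq_imset_card (fun e => [set e.1; e.2]) D); apply: subset_leq_card.
apply/subsetP => e; rewrite !inE => De.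
have /eqP/cards2P[a [b [neq_ab Ee]]] : #|e| = 2.
  by case/orP: De => /andP[_ /[dup]]; [move=> /grE | move=> /grF].
apply/imsetP; exists (a, b) => //; rewrite inE /= /adjacency neq_ab -Ee /=.
by case: (e \in E) (e \in F) De => [] [].
Qed.

Theorem theorem1p1 :
  exists C : R, (0 < C)%R /\
  forall (delta : R) (n : nat) (G : {set {set 'I_n}}) (d : 'I_n -> nat),
    (0 < delta)%R ->
    (/ (delta ^ 2) <= INR n)%R ->
    is_graph G ->
    realizable d ->
    (INR (\sum_(i < n) absdiff (deg G i) (d i)) <= delta * INR n ^ 2)%R ->
    exists G' : {set {set 'I_n}},
      is_graph G' /\
      (INR (symdiff_card G' G) <= C * sqrt delta * INR n ^ 2)%R /\
      (forall i, deg G' i = d i).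
Proof.
exists 40%R; split; first lra.
move=> delta n G d delta_gt0 _ grG [H [grH degH]] close.
have [g [g_sym g_irr deg_g dist_g]] := realize_degrees
  (adjacency_sym G) (adjacency_sym H) (adjacency_irr G) (adjacency_irr H).
have gr_g := edge_set_graph g_irr; have gK := edge_setK g_sym g_irr.
exists (edge_set g); split=> //; split; last first.
  move=> i; rewrite deg_adjacency // -degH [RHS]deg_adjacency // -deg_g.
  by apply: eq_bigr => j _; rewrite gK.
apply: Rle_trans (le_INR _ _ (leP (symdiff_card_le gr_g grG))) _.
under eq_bigr do under eq_bigr do rewrite gK.
apply: Rle_trans dist_g _; rewrite card_ord.
have -> : \sum_u absdiff (\sum_v adjacency G u v) (\sum_v adjacency H u v)
    = \sum_(i < n) absdiff (deg G i) (d i).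
  by apply: eq_bigr => i _; rewrite -degH !deg_adjacency.
have n_ge0 := pos_INR n.
(* The root of [delta * n ^ 2] yields [sqrt delta * n]; the other factor [n] is the number of
   vertices. *)
have := sqrt_le_1_alt _ _ close; rewrite sqrt_mult; [|lra|nra].
rewrite sqrt_pow2 // => sqrt_le.
have -> : (40 * sqrt delta * INR n ^ 2 = 40 * INR n * (sqrt delta * INR n))%R by ring.
by apply: Rmult_le_compat_l sqrt_le; lra.
Qed.
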